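(* Let $c\in(0,\infty)$, $\lambda_\pm:=\frac12\pm(c+\frac14)^{1/2}$, and $\eta_c(t):=\sqrt{t-t^2+c}$. Let $F_c$ and $G_c$ be the functions on $[-1,1]$ given by $$F_c(x):=\begin{cases}\lambda_+x & \text{for } 0\le x\le 1,\\ -\lambda_-x & \text{for } -1\le x<0,\end{cases}\qquad G_c(x):=(1-q^4x^2)^{-1/2}\begin{cases}\eta_c(q^2\lambda_+x) & \text{for } 0\le x\le 1,\\ \eta_c(-q^2\lambda_-x) & \text{for } -1\le x<0.\end{cases}$$ Then the $C^*$-isomorphism $\chi_c=(\pi_+\oplus\pi_-)^{-1}\circ(\pi_+^c\oplus\pi_-^c):C(S^2_{qc})\to C(S^2_{q\infty})$ satisfies $$\chi_c(A_c)=F_c(A)\quad\text{and}\quad \chi_c(B_c)=G_c(A)B,$$ where $F_c(A)$ and $G_c(A)$ are defined by continuous functional calculus.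
   Context: Fix $q\in\mathbb{R}$ with $0<|q|<1$. All algebras are unital and over $\mathbb{C}$. The $C^*$-closure of a $*$-algebra means the completion with respect to the supremum norm over all $*$-representations in bounded operators. $C(S^2_{q\infty})$ is the $C^*$-closure of $P(S^2_{q\infty})$, the quotient of the free $*$-algebra $\mathbb{C}\langle A,B\rangle$ by the two-sided $*$-ideal generated by $A^*=A$, $BA=q^2AB$, $B^*B=-A^2+I$, $BB^*=-q^4A^2+I$. For $c\in(0,\infty)$, $C(S^2_{qc})$ is the $C^*$-closure of $P(S^2_{qc})$, the quotient of $\mathbb{C}\langle A_c,B_c\rangle$ by the two-sided $*$-ideal generated by $A_c^*=A_c$, $B_cA_c=q^2A_cB_c$, $B_c^*B_c=A_c-A_c^2+cI$, $B_cB_c^*=q^2A_c-q^4A_c^2+cI$. Let $\{e_k\}_{k\in\mathbb{N}}$ ($k\ge 0$) be an orthonormal basis of a Hilbert space. The representations $\pi_\pm$ of $C(S^2_{q\infty})$ are given by $\pi_\pm(A)e_k=\pm q^{2k}e_k$, $\pi_\pm(B)e_k=(1-q^{4k})^{1/2}e_{k-1}$ for $k\ge1$, $\pi_\pm(B)e_0=0$. The representations $\pi^c_\pm$ of $C(S^2_{qc})$ are given by $\pi^c_\pm(A_c)e_k=\lambda_\pm q^{2k}e_k$, $\pi^c_\pm(B_c)e_k=c_\pm(k)^{1/2}e_{k-1}$ for $k\ge1$, $\pi^c_\pm(B_c)e_0=0$, where $\lambda_\pm=\frac12\pm(c+\frac14)^{1/2}$ and $c_\pm(k)=\lambda_\pm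 q^{2k}-(\lambda_\pm q^{2k})^2+c$. Let $C^*(\mathfrak{S})$ be the $C^*$-algebra generated by the one-sided shift $\mathfrak{S}e_i=e_{i+1}$, let $\sigma:C^*(\mathfrak{S})\to C(S^1)$ be the symbol map ($\mathfrak{S}\mapsto u$, with $u$ the unitary generator of $C(S^1)$), and let $C^*(\mathfrak{S})\oplus_\sigma C^*(\mathfrak{S}):=\{(a_1,a_2)\in C^*(\mathfrak{S})\oplus C^*(\mathfrak{S})\mid\sigma(a_1)=\sigma(a_2)\}$. It is known that $\pi_+\oplus\pi_-:C(S^2_{q\infty})\to C^*(\mathfrak{S})\oplus_\sigma C^*(\mathfrak{S})$ and $\pi_+^c\oplus\pi_-^c:C(S^2_{qc})\to C^*(\mathfrak{S})\oplus_\sigma C^*(\mathfrak{S})$ are $C^*$-isomorphisms, so $\chi_c$ is well defined. *)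

(* Defs.v *)
From HB Require Import structures.
From mathcomp Require Import all_boot all_order all_algebra.
From mathcomp Require Import finmap.
From mathcomp Require Import all_classical all_reals all_analysis.
From mathcomp Require Import complex.
(* The notations of monalg are incompatible with those of MathComp-Analysis. *)
From mathcomp.multinomials Require Import -(notations) monalg.

Set Implicit Arguments.
Unset Strict Implicit.
Unset Printing Implicit Defensive.

Import Order.TTheory GRing.Theory Num.Theory numFieldNormedType.Exports.

Local Open Scope ring_scope.
Local Open Scope classical_set_scope.
Local Open Scope complex_scope.

HB.mixin Record isStarAlgebra (R : realType) A & GRing.Algebra R[i] A := {
  star : A -> A;
  starD : {morph star : a b / a + b};
  starZ : forall (z : R[i]) a, star (z *: a) = Num.conj z *: star a;
  starM : forall a b, star (a * b) = star b * star a;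
  starK : involutive star
}.

#[short(type="starAlgType")]
HB.structure Definition StarAlgebra (R : realType) :=
  {A of isStarAlgebra R A & GRing.Algebra R[i] A}.

HB.mixin Record isCstarAlgebra (R : realType) A & StarAlgebra R A := {
  cnorm : A -> R;
  cnorm_eq0 : forall a, cnorm a = 0 -> a = 0;
  cnormD : forall a b, cnorm (a + b) <= cnorm a + cnorm b;
  cnormZ : forall (z : R[i]) a, (cnorm (z *: a))%:C = `|z| * (cnorm a)%:C;
  cnormM : forall a b, cnorm (a * b) <= cnorm a * cnorm b;
  cnorm_star : forall a, cnorm (star a * a) = cnorm a ^+ 2;
  cnorm_complete : forall u : nat -> A,
    (forall eps, 0 < eps -> exists N : nat,
       forall m n, (N <= m)%N -> (N <= n)%N -> cnorm (u m - u n) < eps) ->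
    exists l, (fun n => cnorm (u n - l)) @ \oo --> (0 : R)
}.

#[short(type="cstarAlgType")]
HB.structure Definition CstarAlgebra (R : realType) :=
  {A of isCstarAlgebra R A & StarAlgebra R A}.

HB.mixin Record isHilbert (R : realType) H & CompleteNormedModule R[i] H := {
  dot : {dot H for Num.conj};
  dot_norm : forall x : H, dot x x = `|x| ^+ 2
}.

#[short(type="hilbertType")]
HB.structure Definition Hilbert (R : realType) :=
  {H of isHilbert R H & CompleteNormedModule R[i] H}.


(* The free *-algebra on X is the free algebra on the letters (x, false), which
   stands for the generator x, and (x, true), which stands for x^*. *)
Section FreeStarAlgebra.
Variables (R : realType) (X : choiceType).

Local Notation letter := (X * bool)%type.

Definition word_star (w : fmonom letter) : fmonom letter :=
  FMonom (rev [seq (l.1, ~~ l.2) | l <- fmonom_val w]).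

Lemma word_starK : involutive word_star.
Proof.
move=> [s]; rewrite /word_star /= map_rev revK -map_comp.
by congr FMonom; rewrite map_id_in// => -[x b] _ /=; rewrite negbK.
Qed.

Lemma word_star1 : word_star (@mone _) = @mone _.
Proof. by rewrite /word_star fm1; apply/eqP; rewrite fmP fm1. Qed.

Lemma word_starM (v w : fmonom letter) :
  word_star (mmul v w) = mmul (word_star w) (word_star v).
Proof.
by apply/eqP; rewrite fmP fmM /word_star /= fmM map_cat rev_cat.
Qed.

Definition free_star_alg : Type := malg (fmonom letter) R[i].

HB.instance Definition _ := GRing.Lalgebra.on free_star_alg.

Lemma free_star_alg_ind (P : free_star_alg -> Prop) :
  (forall x y, P x -> P y -> P (x + y)) ->
  (forall c w, P (mkmalgU w c)) -> forall x, P x.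
Proof.
move=> PD PU x; rewrite (monalgE x).
by apply: big_ind => //; rewrite -(monalgU0 (mone : fmonom letter)).
Qed.

Lemma free_mulUU c d v w :
  (mkmalgU v c * mkmalgU w d : free_star_alg) = mkmalgU (mmul v w) (c * d).
Proof. exact: fgmulUU. Qed.

Lemma free_scaleU c d w :
  (c *: mkmalgU w d : free_star_alg) = mkmalgU w (c * d).
Proof. by rewrite -mul_malgC free_mulUU mul1m. Qed.

Fact free_scalerAr (k : R[i]) (x y : free_star_alg) :
  k *: (x * y) = x * (k *: y).
Proof.
elim/free_star_alg_ind: x => [x x' IH IH'|c v].
  rewrite (mulrDl x x' y) (mulrDl x x' (k *: y)) scalerDr.
  by rewrite -IH -IH'.
elim/free_star_alg_ind: y => [y y' IH IH'|d w].
  set u : free_star_alg := mkmalgU v c in IH IH' *.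
  rewrite (scalerDr k y y') (mulrDr u y y') (mulrDr u (k *: y)).
  rewrite (scalerDr k (u * y)).
  congr +%R; [exact: IH|exact: IH'].
by rewrite free_scaleU !free_mulUU free_scaleU mulrCA.
Qed.

HB.instance Definition _ :=
  GRing.Lalgebra_isAlgebra.Build R[i] free_star_alg free_scalerAr.

Definition free_star (x : free_star_alg) : free_star_alg :=
  \sum_(w <- msupp x) mkmalgU (word_star w) (Num.conj (mcoeff w x)).

Lemma mcoeff_free_star x w :
  mcoeff w (free_star x) = Num.conj (mcoeff (word_star w) x).
Proof.
rewrite /free_star raddf_sum /=.
have [win|wnin] := boolP (word_star w \in msupp x).
  rewrite (big_fsetD1 _ win) /= mcoeffU word_starK eqxx mulr1n.
  rewrite big_seq big1 ?addr0// => v; rewrite in_fsetD1 => /andP[vw _].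
  rewrite mcoeffU; case: eqP => [E|//]; first by rewrite -E word_starK eqxx in vw.
rewrite mcoeff_outdom// rmorph0 big_seq big1// => v vin.
by rewrite mcoeffU; case: eqP => [E|//]; rewrite -E word_starK vin in wnin.
Qed.

Fact free_starD : {morph free_star : x y / x + y}.
Proof.
by move=> x y; apply/malgP => w; rewrite !(mcoeff_free_star, mcoeffD) rmorphD.
Qed.

Fact free_starZ (z : R[i]) x : free_star (z *: x) = Num.conj z *: free_star x.
Proof.
by apply/malgP => w; rewrite !(mcoeff_free_star, mcoeffZ) rmorphM.
Qed.

Fact free_starK : involutive free_star.
Proof.
by move=> x; apply/malgP => w; rewrite !mcoeff_free_star word_starK conjCK.
Qed.

Lemma free_starU c w :
  free_star (mkmalgU w c) = mkmalgU (word_star w) (Num.conj c).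
Proof.
apply/malgP => v; rewrite mcoeff_free_star !mcoeffU.
by rewrite (can2_eq word_starK word_starK); case: eqP; rewrite ?rmorph0.
Qed.

Fact free_starM x y : free_star (x * y) = free_star y * free_star x.
Proof.
elim/free_star_alg_ind: x => [x x' IH IH'|c v].
  rewrite (mulrDl x x' y) (free_starD (x * y)) (free_starD x).
  by rewrite (mulrDr (free_star y)) -IH -IH'.
elim/free_star_alg_ind: y => [y y' IH IH'|d w].
  set u : free_star_alg := mkmalgU v c in IH IH' *.
  rewrite (mulrDr u y y') (free_starD (u * y)) (free_starD y).
  by rewrite (mulrDl (free_star y)) -IH -IH'.
by rewrite free_mulUU !free_starU free_mulUU word_starM rmorphM mulrC.
Qed.

HB.instance Definition _ := isStarAlgebra.Build R free_star_alg
  free_starD free_starZ free_starM free_starK.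

Definition free_gen (x : X) : free_star_alg := mkmalgU (fmu (x, false)) 1.

End FreeStarAlgebra.
Section StarQuotient.
Variables (R : realType) (A : starAlgType R).

Definition star_ideal (I : set A) : Prop :=
  [/\ I 0, forall x y, I x -> I y -> I (x + y),
      forall a x, I x -> I (a * x), forall a x, I x -> I (x * a) &
      forall x, I x -> I (star x)].

Variable rel : set A.

Definition gen_star_ideal : {pred A} := fun x => `[< smallest star_ideal rel x >].

Lemma gen_star_idealP (x : A) :
  reflect (smallest star_ideal rel x) (x \in gen_star_ideal).
Proof. exact: asboolP. Qed.

Lemma gen_star_idealMl a x : x \in gen_star_ideal -> a * x \in gen_star_ideal.
Proof.
move=> /gen_star_idealP Ix; apply/gen_star_idealP => I Irel.
by case: (Irel.1) => _ _ IMl _ _; exact/IMl/(Ix I Irel).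
Qed.

Lemma gen_star_idealMr a x : x \in gen_star_ideal -> x * a \in gen_star_ideal.
Proof.
move=> /gen_star_idealP Ix; apply/gen_star_idealP => I Irel.
by case: (Irel.1) => _ _ _ IMr _; exact/IMr/(Ix I Irel).
Qed.

Lemma gen_star_ideal_star x : x \in gen_star_ideal -> star x \in gen_star_ideal.
Proof.
move=> /gen_star_idealP Ix; apply/gen_star_idealP => I Irel.
by case: (Irel.1) => _ _ _ _ Istar; exact/Istar/(Ix I Irel).
Qed.

Fact gen_star_ideal_zmod_closed : zmod_closed gen_star_ideal.
Proof.
split=> [|x y xI yI].
  by apply/gen_star_idealP => I [[]].
have /gen_star_idealP NyI := gen_star_idealMl (-1) yI.
move/gen_star_idealP in xI; apply/gen_star_idealP => I Irel.
by case: (Irel.1) => _ ID _ _ _; rewrite -mulN1r; apply: ID; [exact: xI Irel|exact: NyI Irel].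
Qed.

HB.instance Definition _ :=
  GRing.isZmodClosed.Build A gen_star_ideal gen_star_ideal_zmod_closed.

(* Properness of the ideal is required because algebras are nontrivial in
   MathComp. *)
Hypothesis proper : 1 \notin gen_star_ideal.

Definition star_quot : Type := let _ := proper in Quotient.quot gen_star_ideal.

HB.instance Definition _ := GRing.Zmodule.on star_quot.

Definition quot_proj (x : A) : star_quot :=
  (\pi_(Quotient.quot gen_star_ideal) x)%qT.

Let quot_repr (u : star_quot) : A := repr (u : Quotient.quot gen_star_ideal).

Lemma quot_projP x y : quot_proj x = quot_proj y <-> x - y \in gen_star_ideal.
Proof. by rewrite Quotient.idealrBE; split=> [/eqP|/eqP]. Qed.

Let quot_reprK u : quot_proj (quot_repr u) = u.
Proof. exact: reprK. Qed.

Let quot_reprP x : quot_repr (quot_proj x) - x \in gen_star_ideal.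
Proof. by apply/quot_projP; rewrite quot_reprK. Qed.

Lemma quot_projS u : exists x, quot_proj x = u.
Proof. by exists (quot_repr u). Qed.

Lemma quot_projB : {morph quot_proj : x y / x - y}.
Proof. by move=> x y; rewrite /quot_proj raddfB. Qed.

Lemma quot_projD : {morph quot_proj : x y / x + y}.
Proof. by move=> x y; rewrite /quot_proj raddfD. Qed.

Definition quot_one : star_quot := quot_proj 1.
Definition quot_mul (u v : star_quot) := quot_proj (quot_repr u * quot_repr v).
Definition quot_scale (z : R[i]) (u : star_quot) := quot_proj (z *: quot_repr u).
Definition quot_star (u : star_quot) := quot_proj (star (quot_repr u)).

Lemma quot_mulE x y : quot_mul (quot_proj x) (quot_proj y) = quot_proj (x * y).
Proof.
apply/quot_projP; set x' := quot_repr _; set y' := quot_repr _.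
rewrite -[x' * y'](subrK (x * y')) -addrA -mulrBl -mulrBr rpredD//.
- exact/gen_star_idealMr/quot_reprP.
- exact/gen_star_idealMl/quot_reprP.
Qed.

Lemma quot_scaleE z x : quot_scale z (quot_proj x) = quot_proj (z *: x).
Proof.
apply/quot_projP; rewrite -scalerBr -[_ - _]mul1r scalerAl.
exact/gen_star_idealMl/quot_reprP.
Qed.

Lemma quot_starE x : quot_star (quot_proj x) = quot_proj (star x).
Proof.
apply/quot_projP; set x' := quot_repr _.
have -> : star x' - star x = star (x' - x).
  by rewrite starD -[- x]scaleN1r starZ rmorphN1 scaleN1r.
exact/gen_star_ideal_star/quot_reprP.
Qed.

Fact quot_mulA : associative quot_mul.
Proof.
move=> u v w; have [x <-] := quot_projS u; have [y <-] := quot_projS v.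
by have [z <-] := quot_projS w; rewrite !quot_mulE mulrA.
Qed.

Fact quot_mul1 : left_id quot_one quot_mul.
Proof. by move=> u; have [x <-] := quot_projS u; rewrite quot_mulE mul1r. Qed.

Fact quot_mulr1 : right_id quot_one quot_mul.
Proof. by move=> u; have [x <-] := quot_projS u; rewrite quot_mulE mulr1. Qed.

Fact quot_mulDl : left_distributive quot_mul +%R.
Proof.
move=> u v w; have [x <-] := quot_projS u; have [y <-] := quot_projS v.
have [z <-] := quot_projS w.
by rewrite -quot_projD !quot_mulE mulrDl quot_projD.
Qed.

Fact quot_mulDr : right_distributive quot_mul +%R.
Proof.
move=> u v w; have [x <-] := quot_projS u; have [y <-] := quot_projS v.
have [z <-] := quot_projS w.
by rewrite -quot_projD !quot_mulE mulrDr quot_projD.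
Qed.

Fact quot_one_neq0 : quot_one != 0.
Proof.
apply/eqP; have -> : 0 = quot_proj 0 by have := quot_projB 0 0; rewrite !subrr => ->.
by move/quot_projP; rewrite subr0; apply/negP.
Qed.

HB.instance Definition _ := GRing.Zmodule_isNzRing.Build star_quot
  quot_mulA quot_mul1 quot_mulr1 quot_mulDl quot_mulDr quot_one_neq0.

Fact quot_scaleA a b u : quot_scale a (quot_scale b u) = quot_scale (a * b) u.
Proof. by have [x <-] := quot_projS u; rewrite !quot_scaleE scalerA. Qed.

Fact quot_scale1 : left_id 1 quot_scale.
Proof. by move=> u; have [x <-] := quot_projS u; rewrite quot_scaleE scale1r. Qed.

Fact quot_scaleDr : right_distributive quot_scale +%R.
Proof.
move=> a u v; have [x <-] := quot_projS u; have [y <-] := quot_projS v.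
by rewrite -quot_projD !quot_scaleE scalerDr quot_projD.
Qed.

Fact quot_scaleDl u : {morph quot_scale^~ u : a b / a + b}.
Proof.
move=> a b; have [x <-] := quot_projS u.
by rewrite !quot_scaleE scalerDl quot_projD.
Qed.

HB.instance Definition _ := GRing.Zmodule_isLmodule.Build R[i] star_quot
  quot_scaleA quot_scale1 quot_scaleDr quot_scaleDl.

Fact quot_scaleAl (a : R[i]) (u v : star_quot) : a *: (u * v) = (a *: u) * v.
Proof.
have [x <-] := quot_projS u; have [y <-] := quot_projS v.
rewrite [LHS](_ : _ = quot_scale a (quot_mul (quot_proj x) (quot_proj y)))//.
rewrite [RHS](_ : _ = quot_mul (quot_scale a (quot_proj x)) (quot_proj y))//.
by rewrite quot_mulE !quot_scaleE quot_mulE scalerAl.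
Qed.

HB.instance Definition _ :=
  GRing.Lmodule_isLalgebra.Build R[i] star_quot quot_scaleAl.

Fact quot_scaleAr (a : R[i]) (u v : star_quot) : a *: (u * v) = u * (a *: v).
Proof.
have [x <-] := quot_projS u; have [y <-] := quot_projS v.
rewrite [LHS](_ : _ = quot_scale a (quot_mul (quot_proj x) (quot_proj y)))//.
rewrite [RHS](_ : _ = quot_mul (quot_proj x) (quot_scale a (quot_proj y)))//.
by rewrite quot_mulE !quot_scaleE quot_mulE scalerAr.
Qed.

HB.instance Definition _ :=
  GRing.Lalgebra_isAlgebra.Build R[i] star_quot quot_scaleAr.

Fact quot_starD : {morph quot_star : u v / u + v}.
Proof.
move=> u v; have [x <-] := quot_projS u; have [y <-] := quot_projS v.
by rewrite -quot_projD !quot_starE starD quot_projD.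
Qed.

Fact quot_starZ (z : R[i]) u : quot_star (z *: u) = Num.conj z *: quot_star u.
Proof.
have [x <-] := quot_projS u.
rewrite [z *: _](_ : _ = quot_scale z (quot_proj x))//.
rewrite [RHS](_ : _ = quot_scale (Num.conj z) (quot_star (quot_proj x)))//.
by rewrite quot_scaleE !quot_starE quot_scaleE starZ.
Qed.

Fact quot_starM u v : quot_star (u * v) = quot_star v * quot_star u.
Proof.
have [x <-] := quot_projS u; have [y <-] := quot_projS v.
rewrite [_ * quot_proj y](_ : _ = quot_mul (quot_proj x) (quot_proj y))//.
rewrite [RHS](_ : _ = quot_mul (quot_star (quot_proj y))
                               (quot_star (quot_proj x)))//.
by rewrite quot_mulE !quot_starE quot_mulE starM.
Qed.

Fact quot_starK : involutive quot_star.
Proof. by move=> u; have [x <-] := quot_projS u; rewrite !quot_starE starK. Qed.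

HB.instance Definition _ := isStarAlgebra.Build R star_quot
  quot_starD quot_starZ quot_starM quot_starK.

End StarQuotient.

Section Character.
Variables (R : realType) (X : choiceType) (v : X -> R[i]).

Local Notation letter := (X * bool)%type.

Let letter_val (l : letter) := if l.2 then Num.conj (v l.1) else v l.1.

Let word_val (w : fmonom letter) : R[i] :=
  \prod_(l <- fmonom_val w) letter_val l.

Fact word_val_multiplicative : mmorphism word_val.
Proof.
split=> [w w'|]; first by rewrite /word_val fmM big_cat.
by rewrite /word_val fm1 big_nil.
Qed.

HB.instance Definition _ :=
  isMultiplicative.Build (fmonom letter) R[i] word_val
    word_val_multiplicative.

Definition free_char (x : free_star_alg R X) : R[i] := mmap idfun word_val x.

Lemma free_charD : {morph free_char : x y / x + y}.
Proof. exact: mmapD. Qed.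

Lemma free_charU w c : free_char (mkmalgU w c) = c * word_val w.
Proof. exact: mmapU. Qed.

Lemma free_char1 : free_char 1 = 1.
Proof. exact: mmap1. Qed.

Lemma free_charM : {morph free_char : x y / x * y}.
Proof. exact: (rmorphM (mmap idfun word_val)). Qed.

Lemma free_charZ z x : free_char (z *: x) = z * free_char x.
Proof. exact: mmapZ. Qed.

Lemma free_charN x : free_char (- x) = - free_char x.
Proof. by rewrite -scaleN1r free_charZ mulN1r. Qed.

Lemma free_char_star x : free_char (star x) = Num.conj (free_char x).
Proof.
elim/free_star_alg_ind: x => [x y IHx IHy|c w].
  rewrite starD (free_charD (star x)) (free_charD x y) rmorphD.
  by congr +%R; [exact: IHx|exact: IHy].
rewrite [star _]free_starU !free_charU rmorphM; congr (_ * _).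
rewrite /word_val /word_star /= bigop.big_rev big_map rmorph_prod /=.
by apply: eq_bigr => -[x []] _; rewrite /letter_val /= ?conjCK.
Qed.

Lemma free_char_gen x : free_char (free_gen R x) = v x.
Proof. by rewrite free_charU mul1r /word_val fmU big_seq1. Qed.

Lemma free_char_proper (rel : set (free_star_alg R X)) :
  (forall x, rel x -> free_char x = 0) -> 1 \notin gen_star_ideal rel.
Proof.
move=> rel0; apply/negP => /gen_star_idealP I1.
have : free_char 1 = 0; last by rewrite free_char1 => /eqP; rewrite oner_eq0.
apply: (I1 [set x | free_char x = 0]); split=> //.
split=> /= [|x y xI yI|a x xI|a x xI|x xI].
- exact: mmap0.
- by rewrite free_charD xI yI addr0.
- by rewrite free_charM xI mulr0.
- by rewrite free_charM xI mul0r.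
- by rewrite free_char_star xI rmorph0.
Qed.
End Character.

Section Podles.
Variables (R : realType) (q : R).

Definition genA : free_star_alg R bool := free_gen R false.
Definition genB : free_star_alg R bool := free_gen R true.

Definition podles_inf_rel : set (free_star_alg R bool) :=
  [set star genA - genA;
       genB * genA - (q ^+ 2)%:C *: (genA * genB);
       star genB * genB - (- genA ^+ 2 + 1);
       genB * star genB - (- ((q ^+ 4)%:C *: genA ^+ 2) + 1)].

Definition podles_rel (c : R) : set (free_star_alg R bool) :=
  [set star genA - genA;
       genB * genA - (q ^+ 2)%:C *: (genA * genB);
       star genB * genB - (genA - genA ^+ 2 + c%:C *: 1);
       genB * star genB -
         ((q ^+ 2)%:C *: genA - (q ^+ 4)%:C *: genA ^+ 2 + c%:C *: 1)].

Let char_val (b : R) (g : bool) : R[i] := if g then b%:C else 0.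

Section Proper.
Variable b : R.
Local Notation chi := (free_char (char_val b)).

Let chiA : chi genA = 0. Proof. exact: free_char_gen. Qed.
Let chiB : chi genB = b%:C. Proof. exact: free_char_gen. Qed.

Let chiB' : chi (star genB) = b%:C.
Proof. by rewrite free_char_star chiB [LHS]conjc_real. Qed.

Let chi_selfadj : chi (star genA - genA) = 0.
Proof.
by rewrite free_charD free_char_star free_charN chiA rmorph0 oppr0 addr0.
Qed.

Let chiAM x : chi (genA * x) = 0.
Proof. by rewrite free_charM chiA mul0r. Qed.

Let chiAZ z : chi (z *: genA ^+ 2) = 0.
Proof. by rewrite free_charZ expr2 chiAM mulr0. Qed.

Let chi_comm z : chi (genB * genA - z *: (genA * genB)) = 0.
Proof.
by rewrite free_charD free_charM chiA free_charN free_charZ chiAM !mulr0 subr0.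
Qed.

Let chi_sphere x y z : chi x = (b ^+ 2)%:C -> chi y = 0 -> z = (b ^+ 2)%:C ->
  chi (x - (y + z *: 1)) = 0.
Proof.
move=> xE yE ->; rewrite free_charD free_charN free_charD free_charZ.
by rewrite free_char1 xE yE add0r mulr1 subrr.
Qed.

Let chi1 : chi (star genB * genB) = (b ^+ 2)%:C.
Proof. by rewrite free_charM chiB' chiB -rmorphM. Qed.

Let chi2 : chi (genB * star genB) = (b ^+ 2)%:C.
Proof. by rewrite free_charM chiB' chiB -rmorphM. Qed.

Lemma podles_inf_proper_subproof x :
  b = 1 -> podles_inf_rel x -> chi x = 0.
Proof.
move=> b1; case=> [[[]|]|] ->.
- exact: chi_selfadj.
- exact: chi_comm.
- have := @chi_sphere _ (- genA ^+ 2) 1 chi1; rewrite scale1r; apply.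
    by rewrite free_charN expr2 chiAM oppr0.
  by rewrite b1 expr1n.
- have := @chi_sphere _ (- ((q ^+ 4)%:C *: genA ^+ 2)) 1 chi2.
  rewrite scale1r; apply; first by rewrite free_charN chiAZ oppr0.
  by rewrite b1 expr1n.
Qed.

Lemma podles_proper_subproof c x :
  b ^+ 2 = c -> podles_rel c x -> chi x = 0.
Proof.
move=> bE; case=> [[[]|]|] ->.
- exact: chi_selfadj.
- exact: chi_comm.
- apply: chi_sphere; first exact: chi1.
    by rewrite free_charD chiA free_charN expr2 chiAM subr0.
  by rewrite bE.
- apply: chi_sphere; first exact: chi2.
    by rewrite free_charD free_charZ chiA free_charN chiAZ mulr0 subr0.
  by rewrite bE.
Qed.

End Proper.

Fact podles_inf_proper : 1 \notin gen_star_ideal podles_inf_rel.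
Proof.
apply: (@free_char_proper _ _ (char_val 1)) => x.
exact: podles_inf_proper_subproof.
Qed.

Fact podles_proper (c : R) : 0 < c -> 1 \notin gen_star_ideal (podles_rel c).
Proof.
move=> c_gt0; apply: (@free_char_proper _ _ (char_val (Num.sqrt c))) => x.
apply: podles_proper_subproof.
by rewrite sqr_sqrtr// ltW.
Qed.

Definition podles_inf : starAlgType R := star_quot podles_inf_proper.

Definition podles (c : R) (c_gt0 : 0 < c) : starAlgType R :=
  star_quot (podles_proper c_gt0).

Definition podles_infA : podles_inf := quot_proj podles_inf_proper genA.
Definition podles_infB : podles_inf := quot_proj podles_inf_proper genB.

Definition podlesA (c : R) (c_gt0 : 0 < c) : podles c_gt0 :=
  quot_proj (podles_proper c_gt0) genA.
Definition podlesB (c : R) (c_gt0 : 0 < c) : podles c_gt0 :=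
  quot_proj (podles_proper c_gt0) genB.

End Podles.

Section Operators.
Variables (R : realType) (H : hilbertType R).

Definition op_bound (T : H -> H) (M : R) : Prop :=
  forall x, `|T x| <= M%:C * `|x|.

Definition bounded_op (T : H -> H) : Prop :=
  linear T /\ exists M, op_bound T M.

Definition op_norm (T : H -> H) : R := inf [set M | 0 <= M /\ op_bound T M].

Definition adjoint (T T' : H -> H) : Prop :=
  forall x y, dot (T x) y = dot x (T' y).

Record is_star_rep (A : starAlgType R) (pi : A -> H -> H) : Prop := {
  rep_bounded : forall a, bounded_op (pi a);
  rep1 : forall x, pi 1 x = x;
  repD : forall a b x, pi (a + b) x = pi a x + pi b x;
  repZ : forall (z : R[i]) a x, pi (z *: a) x = z *: pi a x;
  repM : forall a b x, pi (a * b) x = pi a (pi b x);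
  rep_star : forall a, adjoint (pi a) (pi (star a))
}.

(* The unital C*-subalgebras of the algebra of bounded operators on H. *)
Record is_cstar_subalg (D : set (H -> H)) : Prop := {
  subalg_bounded : forall T, D T -> bounded_op T;
  subalg1 : D id;
  subalgD : forall T U, D T -> D U -> D (fun x => T x + U x);
  subalgZ : forall (z : R[i]) T, D T -> D (fun x => z *: T x);
  subalgM : forall T U, D T -> D U -> D (T \o U);
  subalg_star : forall T T', D T -> adjoint T T' -> D T';
  subalg_closed : forall T, bounded_op T ->
    (forall eps, 0 < eps ->
       exists2 U, D U & op_norm (fun x => T x - U x) < eps) -> D T
}.

Definition cstar_gen (S : H -> H) : set (H -> H) :=
  smallest is_cstar_subalg [set S].

Definition orthonormal_basis (e : nat -> H) : Prop :=
  (forall i j, dot (e i) (e j) = (i == j)%:R) /\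
  (forall x, series (fun k => dot x (e k) *: e k) @ \oo --> x).

Definition is_shift (e : nat -> H) (S : H -> H) : Prop :=
  bounded_op S /\ forall i, S (e i) = e i.+1.

Definition circle : set R[i]^o := [set z | `|z| = 1].

(* C(S^1) is represented by the functions R[i] -> R[i] that are continuous on
   the unit circle, only their values on the circle being relevant.  The symbol
   map is the unital *-homomorphism C*(S) -> C(S^1) sending S to the generator
   z |-> z of C(S^1). *)
Record is_symbol_map (S : H -> H) (sigma : (H -> H) -> R[i]^o -> R[i]^o) :
    Prop := {
  symbol_continuous : forall T, cstar_gen S T ->
    {within circle, continuous (sigma T)};
  symbol1 : {in circle, sigma id =1 fun=> 1};
  symbolD : forall T U, cstar_gen S T -> cstar_gen S U ->
    {in circle, sigma (fun x => T x + U x) =1 fun z => sigma T z + sigma U z};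
  symbolZ : forall (c : R[i]) T, cstar_gen S T ->
    {in circle, sigma (fun x => c *: T x) =1 fun z => c * sigma T z};
  symbolM : forall T U, cstar_gen S T -> cstar_gen S U ->
    {in circle, sigma (T \o U) =1 fun z => sigma T z * sigma U z};
  symbol_star : forall T T', cstar_gen S T -> adjoint T T' ->
    {in circle, sigma T' =1 fun z => Num.conj (sigma T z)};
  symbol_shift : {in circle, sigma S =1 id}
}.

(* The fibre product of two copies of C*(S) over the symbol map. *)
Definition toeplitz_pullback (S : H -> H)
    (sigma : (H -> H) -> R[i]^o -> R[i]^o) : set ((H -> H) * (H -> H)) :=
  [set T | [/\ cstar_gen S T.1, cstar_gen S T.2 &
               {in circle, sigma T.1 =1 sigma T.2}]].

Definition rep_sum (A : starAlgType R) (pi1 pi2 : A -> H -> H) (a : A) :=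
  (pi1 a, pi2 a).

(* pi1 (+) pi2 is an isomorphism of C*-algebras from A onto D, the norm of a
   pair of operators being the maximum of the norms of its components. *)
Definition is_cstar_iso (A : cstarAlgType R) (pi1 pi2 : A -> H -> H)
    (D : set ((H -> H) * (H -> H))) : Prop :=
  [/\ is_star_rep pi1, is_star_rep pi2, set_bij setT D (rep_sum pi1 pi2) &
      forall a, cnorm a = Num.max (op_norm (pi1 a)) (op_norm (pi2 a))].

End Operators.

(* The C*-closure of P is determined up to isomorphism as a C*-algebra A together
   with a *-homomorphism iota from P onto a dense *-subalgebra, such that the
   norm of iota p is the supremum of the norms of p in all the
   *-representations of P by bounded operators. *)
Record is_cstar_closure (R : realType) (P : starAlgType R)
    (A : cstarAlgType R) (iota : {lrmorphism P -> A}) : Prop := {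
  closure_star : {morph iota : p / star p};
  closure_dense : forall a eps, 0 < eps -> exists p, cnorm (a - iota p) < eps;
  closure_norm : forall p, (cnorm (iota p))%:E = ereal_sup
    [set r | exists (H : hilbertType R) (pi : P -> H -> H),
               is_star_rep pi /\ r = (op_norm (pi p))%:E]
}.

Section FunctionalCalculus.
Variables (R : realType) (A : cstarAlgType R).

Definition spectrum (a : A) : set R[i] :=
  [set z | ~ exists b, b * (a - z%:A) = 1 /\ (a - z%:A) * b = 1].

Definition real_spectrum (a : A) : set R := [set t | spectrum a t%:C].

Definition poly_calculus (a : A) (p : {poly R}) : A :=
  horner_alg a (map_poly (real_complex R) p).

(* x = f(a) for a self-adjoint element a (whose spectrum is real) and a real
   function f: the continuous functional calculus of a is the extension by
   continuity of the polynomial one, f(a) being the limit of (p n)(a) for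
   polynomials p n converging to f uniformly on the spectrum of a. *)
Definition is_cfc (a : A) (f : R -> R) (x : A) : Prop :=
  exists p : nat -> {poly R},
    {uniform real_spectrum a, (fun n t => (p n).[t]) @ \oo --> f} /\
    (fun n => cnorm (poly_calculus a (p n) - x)) @ \oo --> (0 : R).

Definition cfc (a : A) (f : R -> R) : A := xget 0 [set x | is_cfc a f x].

End FunctionalCalculus.

Section PodlesRepresentations.
Variables (R : realType) (q : R) (H : hilbertType R) (e : nat -> H).

(* pi_+ and pi_- are obtained for s = 1 and s = -1. *)
Record is_podles_inf_rep (A : cstarAlgType R) (a b : A) (s : R)
    (pi : A -> H -> H) : Prop := {
  podles_inf_rep_star : is_star_rep pi;
  podles_inf_repA : forall k, pi a (e k) = (s * q ^+ (2 * k))%:C *: e k;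
  podles_inf_repB0 : pi b (e 0%N) = 0;
  podles_inf_repB : forall k, (1 <= k)%N ->
    pi b (e k) = (Num.sqrt (1 - q ^+ (4 * k)))%:C *: e k.-1
}.

Definition lambda_plus (c : R) : R := 2^-1 + Num.sqrt (c + 4^-1).
Definition lambda_minus (c : R) : R := 2^-1 - Num.sqrt (c + 4^-1).

(* pi^c_+ and pi^c_- are obtained for l = lambda_+ and l = lambda_-. *)
Record is_podles_rep (c : R) (A : cstarAlgType R) (a b : A) (l : R)
    (pi : A -> H -> H) : Prop := {
  podles_rep_star : is_star_rep pi;
  podles_repA : forall k, pi a (e k) = (l * q ^+ (2 * k))%:C *: e k;
  podles_repB0 : pi b (e 0%N) = 0;
  podles_repB : forall k, (1 <= k)%N ->
    pi b (e k) =
      (Num.sqrt (l * q ^+ (2 * k) - (l * q ^+ (2 * k)) ^+ 2 + c))%:C *: e k.-1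
}.

Definition eta (c t : R) : R := Num.sqrt (t - t ^+ 2 + c).

(* Only the values on [-1, 1] of the next two functions are relevant: they are
   applied to an element whose spectrum is contained in [-1, 1]. *)
Definition podles_F (c x : R) : R :=
  if 0 <= x then lambda_plus c * x else - lambda_minus c * x.

Definition podles_G (c x : R) : R :=
  (Num.sqrt (1 - q ^+ 4 * x ^+ 2))^-1 *
  (if 0 <= x then eta c (q ^+ 2 * lambda_plus c * x)
   else eta c (- q ^+ 2 * lambda_minus c * x)).

End PodlesRepresentations.

(* Main.v *)
Require Import Defs.
From HB Require Import structures.
From mathcomp Require Import all_boot all_order all_algebra.
From mathcomp Require Import finmap.
From mathcomp Require Import all_classical all_reals all_analysis.
From mathcomp Require Import complex.
From mathcomp Require Import ring lra.

Set Implicit Arguments.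
Unset Strict Implicit.
Unset Printing Implicit Defensive.

Import Order.TTheory GRing.Theory Num.Theory numFieldNormedType.Exports.

Local Open Scope ring_scope.
Local Open Scope classical_set_scope.
Local Open Scope complex_scope.

(** An element of the target algebra is determined by its images under [pip] and
    [pim], and a bounded operator by its values on the basis, so both equations
    can be checked on basis vectors. There [chi_c] is transparent: composing it
    with [pip] and [pim] gives [picp] and [picm]. On the other side, [A] is
    diagonal with eigenvalues [q ^+ (2 * k)] and [- q ^+ (2 * k)], so [f(A)] is
    diagonal with the values of [f] at these points ([rep_cfc]). The function
    [F] multiplies the positive eigenvalues by [lambda_plus] and turns the
    negative ones [- q ^+ (2 * k)] into [lambda_minus * q ^+ (2 * k)]: these are
    the eigenvalues of [A_c]. Both [B] and [B_c] are
    weighted shifts, and [G] exchanges their weights ([podles_G_shift]).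

    What remains is that [F(A)] and [G(A)] exist. Both functions are continuous
    on [[-1, 1]], hence uniform limits of polynomials there ([weierstrass]). The
    C*-norm is the maximum of the norms of the two component operators, and a
    diagonal operator is bounded by the supremum of its eigenvalues
    ([diagonal_op_bound]), so the polynomials in [A] form a Cauchy sequence and
    converge ([cfc_diagonal_exists]). The calculus demands uniform convergence
    on the whole spectrum of [A]; the Neumann series ([one_sub_invertible])
    shows that the spectrum is contained in [[-1, 1]]. *)

(** * Polynomial approximation *)

Section Weierstrass.
Variable R : realType.

(** The mean of [f] at the number of successes in [n] independent trials of
    success probability ['X], by conditioning on one trial; in closed form it is
    the sum of the ['C(n, k)%:R *: ('X ^+ k * (1 - 'X) ^+ (n - k) * (f k)%:P)],
    a Bernstein polynomial. The recursion lets every moment be computed by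
    induction on [n], with no identity between binomial coefficients. *)
Fixpoint bernoulli_mean (n : nat) (f : nat -> R) : {poly R} :=
  if n is n'.+1 then
    'X * bernoulli_mean n' (f \o succn) + (1 - 'X) * bernoulli_mean n' f
  else (f 0%N)%:P.

Lemma bernoulli_meanS n f t : (bernoulli_mean n.+1 f).[t] =
  t * (bernoulli_mean n (f \o succn)).[t] + (1 - t) * (bernoulli_mean n f).[t].
Proof. by rewrite /= !hornerE. Qed.

Lemma bernoulli_mean_shift n f a t :
  (bernoulli_mean n (fun k => f k - a)).[t] = (bernoulli_mean n f).[t] - a.
Proof.
elim: n f => [|n IH] f; first by rewrite /= !hornerC.
by rewrite !bernoulli_meanS (IH (f \o succn)) IH; ring.
Qed.

Lemma bernoulli_mean_affine n f a b t :
  (bernoulli_mean n (fun k => a + b * f k)).[t] =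
  a + b * (bernoulli_mean n f).[t].
Proof.
elim: n f => [|n IH] f; first by rewrite /= !hornerC.
by rewrite !bernoulli_meanS (IH (f \o succn)) IH; ring.
Qed.

(** The hypothesis is on [k <= n] because a walk of [n] steps goes no further;
    this keeps the nodes of an approximation inside the given interval. *)
Lemma ler_norm_bernoulli_mean n f g t : 0 <= t <= 1 ->
  (forall k, (k <= n)%N -> `|f k| <= g k) ->
  `|(bernoulli_mean n f).[t]| <= (bernoulli_mean n g).[t].
Proof.
move=> t01; elim: n f g => [|n IH] f g fg.
  by rewrite /= !hornerC; exact: fg.
rewrite !bernoulli_meanS (le_trans (ler_normD _ _))// !normrM.
have [t0 t1] := andP t01.
have t1' : 0 <= 1 - t by rewrite subr_ge0.
rewrite (ger0_norm t0) (ger0_norm t1') lerD// ler_wpM2l//.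
- by apply: IH => k kn; exact: fg.
- by apply: IH => k kn; apply: fg; exact: leqW.
Qed.

(** The mean is [n t] and the variance [n t (1 - t)]. An arbitrary centre [a] is
    kept because one more success amounts to replacing [a] by [a - 1]. *)
Lemma bernoulli_mean_sqr n a t :
  (bernoulli_mean n (fun k => (k%:R - a) ^+ 2)).[t] =
  (n%:R * t - a) ^+ 2 + n%:R * t * (1 - t).
Proof.
elim: n a => [|n IH] a; first by rewrite /= hornerC; ring.
rewrite bernoulli_meanS IH.
have -> : ((fun k => (k%:R - a) ^+ 2) \o succn) =
          (fun k : nat => (k%:R - (a - 1)) ^+ 2).
  by apply/funext => k /=; rewrite -natr1; ring.
by rewrite IH -natr1; ring.
Qed.

(** Uniform continuity in the form that integrates against a variance: close
    points are covered by [eps], and for points at distance at least [d / 2] the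
    crude bound [2 * K] on the oscillation is absorbed by the quadratic term.
    The same [C] serves at all points by compactness. *)
Lemma continuous_quadratic_modulus (a b : R) (f : R -> R) (eps : R) :
  {within `[a, b], continuous f} -> 0 < eps ->
  exists2 C, 0 <= C & forall s t, s \in `[a, b]%R -> t \in `[a, b]%R ->
    `|f s - f t| <= eps + C * (s - t) ^+ 2.
Proof.
move=> fC eps0.
have [M [_ MP]] :=
  compact_bounded (continuous_compact fC (@segment_compact R a b)).
pose K := M + 1.
have fK s : s \in `[a, b]%R -> `|f s| <= K.
  move=> sab; apply: (MP K); first by rewrite /K ltrDl.
  by exists s.
have /compact_near_coveringP/near_covering_withinP cov :=
  @segment_compact R a b.
have [|C [_ CP]] := cov R +oo (fun C s => forall t, t \in `[a, b]%R ->
    `|f s - f t| <= eps + C * (s - t) ^+ 2) _.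
  move=> x xab.
  move/subspace_continuousP : (fC) => /(_ x xab)/cvgrPdist_lt/(_ (eps / 2)).
  rewrite divr_gt0// => /(_ isT); rewrite near_withinE => -[d /= d0 dP].
  have fx y : y \in `[a, b]%R -> `|x - y| < d -> `|f x - f y| < eps / 2.
    by move=> yab xyd; apply: dP.
  (* [d / 2] leaves room for [t]: if [s] is within [d / 2] of both [x] and [t],
     then [t] is within [d] of [x]. *)
  pose D := 2 * K / (d / 2) ^+ 2.
  exists (ball x (d / 2), [set C | D < C]) => /=.
    split; first by apply: nbhsx_ballx; rewrite divr_gt0.
    by exists D; split => //; exact: num_real.
  move=> [s C] [/= xs DC] sab t tab.
  have K0 : 0 <= K := le_trans (normr_ge0 _) (fK _ sab).
  have D0 : 0 <= D by apply: divr_ge0; [exact: mulr_ge0|exact: sqr_ge0].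
  have C0 : 0 <= C := ltW (le_lt_trans D0 DC).
  have [st|st] := ltP `|s - t| (d / 2).
    have xsd : `|x - s| < d by apply: lt_trans xs _; lra.
    have xtd : `|x - t| < d.
      by have := ler_distD s x t; have : `|x - s| < d / 2 := xs; lra.
    have := ler_distD (f x) (f s) (f t); rewrite (distrC (f s) (f x)).
    have := fx _ sab xsd; have := fx _ tab xtd.
    have : 0 <= C * (s - t) ^+ 2 by rewrite mulr_ge0// sqr_ge0.
    lra.
  have CK : 2 * K <= C * (s - t) ^+ 2.
    have -> : 2 * K = D * (d / 2) ^+ 2.
      by rewrite /D divfK// expf_neq0// lt0r_neq0// divr_gt0.
    apply: ler_pM; [exact: D0|exact: sqr_ge0|exact: ltW|].
    rewrite -(real_normK (num_real (s - t))) ler_pXn2r// nnegrE.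
    by rewrite ltW// divr_gt0.
  have := ler_normB (f s) (f t); have := fK _ sab; have := fK _ tab; lra.
exists (Num.max 0 (C + 1)); first by rewrite le_max lexx.
move=> s t sab tab; apply: (CP (Num.max 0 (C + 1))) => //.
by rewrite lt_max ltrDl ltr01 orbT.
Qed.

(** The mean of [f] at the nodes [a + (b - a) * k / N], with [k] binomial of
    parameters [N] and [t = (x - a) / (b - a)], differs from [f x] by at most
    the mean of [eps / 2 + C * (node - x) ^+ 2], and the second term is [C]
    times a variance of order [1 / N]. *)
Lemma weierstrass (a b : R) (f : R -> R) (eps : R) : a < b ->
  {within `[a, b], continuous f} -> 0 < eps ->
  exists p : {poly R}, forall x, x \in `[a, b]%R -> `|p.[x] - f x| <= eps.
Proof.
move=> ab fC eps0; have ba0 : 0 < b - a by rewrite subr_gt0.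
have [C C0 fQ] := continuous_quadratic_modulus fC (divr_gt0 eps0 (ltr0n R 2)).
pose K := C * (b - a) ^+ 2.
have K0 : 0 <= K by rewrite mulr_ge0// sqr_ge0.
have [N NK] : exists N : nat, 2 * K / eps < N%:R.
  by exists (Num.truncn (2 * K / eps)).+1; exact: truncnS_gt.
have N0 : 0 < N%:R :> R.
  by apply: le_lt_trans NK; rewrite divr_ge0 ?mulr_ge0// ltW.
pose node (k : nat) : R := a + (b - a) * (k%:R / N%:R).
exists (bernoulli_mean N (f \o node) \Po ((b - a)^-1 *: ('X - a%:P))) => x xab.
rewrite horner_comp !hornerE.
set t : R := (b - a)^-1 * (x - a).
have xE : x = a + (b - a) * t by rewrite /t; field; rewrite lt0r_neq0.
have t01 : 0 <= t <= 1.
  move: xab; rewrite in_itv /= => /andP[ax xb].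
  rewrite /t mulrC divr_ge0 ?subr_ge0 ?(ltW ab)//=.
  by rewrite ler_pdivrMr// mul1r lerD2r.
rewrite -bernoulli_mean_shift.
pose g (k : nat) := eps / 2 + K / N%:R ^+ 2 * (k%:R - N%:R * t) ^+ 2.
apply: (@le_trans _ _ (bernoulli_mean N g).[t]).
  apply: ler_norm_bernoulli_mean => // k kN /=.
  apply: (le_trans (fQ (node k) x _ xab)).
    have : 0 <= (k%:R / N%:R : R) by rewrite divr_ge0.
    have : (k%:R / N%:R : R) <= 1 by rewrite ler_pdivrMr// mul1r ler_nat.
    by rewrite in_itv /= /node; nra.
  rewrite /g /node /K xE lerD2l le_eqVlt; apply/orP; left; apply/eqP.
  by field; rewrite lt0r_neq0.
rewrite (bernoulli_mean_affine N (fun k => (k%:R - N%:R * t) ^+ 2)).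
rewrite bernoulli_mean_sqr subrr expr0n add0r.
have -> : K / N%:R ^+ 2 * (N%:R * t * (1 - t)) = K * (t * (1 - t)) / N%:R.
  by field; rewrite lt0r_neq0.
have tt : t * (1 - t) <= 1 by have := sqr_ge0 t; nra.
have : K * (t * (1 - t)) / N%:R <= eps / 2; last lra.
rewrite ler_pdivrMr//; apply: (@le_trans _ _ K).
  by rewrite -[leRHS]mulr1 ler_wpM2l.
by move: NK; rewrite ltr_pdivrMr//; lra.
Qed.

End Weierstrass.

(** * Norm and spectrum in C*-algebras *)

Section CstarNorm.
Variables (R : realType) (A : cstarAlgType R).
Implicit Types (a b x y : A) (z : R[i]).

Lemma cnormZr z x : cnorm (z *: x) = complex.Re `|z| * cnorm x.
Proof.
have := cnormZ z x; rewrite -(RRe_real (normr_real z)) -rmorphM.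
exact: complexI.
Qed.

Lemma cnorm0 : cnorm (0 : A) = 0.
Proof. by rewrite -(scale0r (0 : A)) cnormZr normr0 mul0r. Qed.

Lemma cnormN x : cnorm (- x) = cnorm x.
Proof. by rewrite -scaleN1r cnormZr normrN1 mul1r. Qed.

Lemma cnorm_ge0 x : 0 <= cnorm x.
Proof. by have := cnormD x (- x); rewrite subrr cnorm0 cnormN; lra. Qed.

Lemma cnorm1 : cnorm (1 : A) = 1.
Proof.
have star1 : star (1 : A) = 1.
  by rewrite -[LHS]mul1r -[X in X * _](@starK R A) -starM mul1r starK.
have := cnorm_star (1 : A); rewrite star1 mulr1 => /eqP.
rewrite -subr_eq0 expr2 -[X in X - _]mulr1 -mulrBr mulf_eq0 => /orP[|].
  by move=> /eqP/cnorm_eq0/eqP; rewrite oner_eq0.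
by rewrite subr_eq0 => /eqP.
Qed.

Lemma cnormX x n : cnorm (x ^+ n) <= cnorm x ^+ n.
Proof.
elim: n => [|n IH]; first by rewrite !expr0 cnorm1.
by rewrite !exprS (le_trans (cnormM _ _))// ler_wpM2l// cnorm_ge0.
Qed.

Lemma cnorm_small_eq0 x : (forall eps, 0 < eps -> cnorm x <= eps) -> x = 0.
Proof.
move=> xeps; apply: cnorm_eq0; apply/eqP; rewrite eq_le cnorm_ge0 andbT.
by apply/ler_addgt0Pr => eps eps0; rewrite add0r xeps.
Qed.

Lemma geometric_sumE x n :
  (1 - x) * (\sum_(i < n) x ^+ i) = 1 - x ^+ n /\
  (\sum_(i < n) x ^+ i) * (1 - x) = 1 - x ^+ n.
Proof.
elim: n => [|n [IHl IHr]]; first by rewrite big_ord0 mulr0 mul0r expr0 subrr.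
rewrite big_ord_recr /= mulrDr IHl (mulrDl _ _ (1 - x)) IHr.
by rewrite mulrBl mulrBr mul1r mulr1 -exprS -exprSr addrA subrK.
Qed.

Lemma cnorm_geometric_sum x n : cnorm x < 1 ->
  cnorm (\sum_(i < n) x ^+ i) <= (1 - cnorm x)^-1.
Proof.
move=> x1; have x0 := cnorm_ge0 x.
apply: (@le_trans _ _ ((1 - cnorm x ^+ n) / (1 - cnorm x))).
  elim: n => [|n IH]; first by rewrite big_ord0 cnorm0 expr0 subrr mul0r.
  rewrite big_ord_recr /= (le_trans (cnormD _ _))//.
  rewrite (le_trans (lerD IH (cnormX x n)))// le_eqVlt; apply/orP; left.
  by apply/eqP; rewrite exprS; field; rewrite subr_eq0 gt_eqF.
rewrite -[leRHS]mul1r ler_wpM2r ?invr_ge0 ?subr_ge0 ?(ltW x1)//.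
by rewrite lerBlDr lerDl exprn_ge0.
Qed.

Lemma geometric_small (r eps : R) : 0 <= r < 1 -> 0 < eps ->
  exists N, forall n, (N <= n)%N -> r ^+ n <= eps.
Proof.
move=> /andP[r0 r1] eps0.
have /cvg_expr/cvgrPdist_le/(_ eps eps0)[N _ NP] : `|r| < 1.
  by rewrite ger0_norm.
exists N => n /NP /=.
by rewrite sub0r normrN ger0_norm// exprn_ge0.
Qed.

(** Neumann series: the partial sums of the powers of [x] form a Cauchy sequence,
    and its limit is the inverse, on both sides, because multiplying the partial
    sums by [1 - x] gives [1 - x ^+ n]. *)
Lemma one_sub_invertible x : cnorm x < 1 ->
  exists b, b * (1 - x) = 1 /\ (1 - x) * b = 1.
Proof.
move=> x1; have x0 := cnorm_ge0 x; set r := cnorm x.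
have r01 : 0 <= r < 1 by rewrite x0.
have r1 : 0 < 1 - r by rewrite subr_gt0.
pose s n : A := \sum_(i < n) x ^+ i.
have sD n k : s (n + k)%N - s n = x ^+ n * s k.
  rewrite /s big_split_ord /= addrAC subrr add0r mulr_sumr.
  by apply: eq_bigr => i _; rewrite exprD.
have small eps : 0 < eps -> exists N, forall n, (N <= n)%N -> r ^+ n <= eps.
  exact: geometric_small.
have [|l lP] := cnorm_complete s.
  move=> eps eps0; have [|N NP] := small (eps / 2 * (1 - r)).
    by rewrite mulr_gt0// divr_gt0.
  have sNk k n : (N <= n)%N -> cnorm (s (n + k)%N - s n) <= eps / 2.
    move=> Nn; rewrite sD (le_trans (cnormM _ _))//.
    rewrite -[leRHS](mulfK (lt0r_neq0 r1)) ler_pM ?cnorm_ge0//.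
      by rewrite (le_trans (cnormX _ _))// NP.
    exact: cnorm_geometric_sum.
  have sN m n : (N <= m)%N -> (m <= n)%N -> cnorm (s m - s n) < eps.
    by move=> Nm mn; rewrite -cnormN opprB -(subnKC mn);
       have := sNk (n - m)%N m Nm; lra.
  exists N => m n Nm Nn; have [mn|/ltnW nm] := leqP m n; first exact: sN.
  by rewrite -cnormN opprB; exact: sN.
have slim eps : 0 < eps ->
    exists2 n, cnorm (s n - l) <= eps & r ^+ n <= eps.
  move=> eps0; have [N NP] := small _ eps0.
  move/cvgrPdist_le : lP => /(_ eps eps0)[M _ MP].
  exists (maxn M N); last by apply: NP; exact: leq_maxr.
  have := MP (maxn M N) (leq_maxl _ _).
  by rewrite /= sub0r normrN ger0_norm// cnorm_ge0.
have vanish (u : A) :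
    (forall n, cnorm u <= cnorm (1 - x) * cnorm (s n - l) + r ^+ n) -> u = 0.
  move=> uP; apply: cnorm_small_eq0 => eps eps0.
  pose K := cnorm (1 - x) + 1.
  have K0 : 0 < K by rewrite ltr_wpDl// cnorm_ge0.
  have [n sn rn] := slim (eps / K) (divr_gt0 eps0 K0).
  rewrite (le_trans (uP n))//.
  have -> : eps = cnorm (1 - x) * (eps / K) + eps / K.
    by rewrite /K; field; rewrite lt0r_neq0.
  by rewrite lerD// ler_wpM2l// cnorm_ge0.
exists l; split; apply/eqP; rewrite -subr_eq0; apply/eqP/vanish => n.
  have -> : l * (1 - x) - 1 = - ((s n - l) * (1 - x)) - x ^+ n.
    rewrite mulrBl (geometric_sumE x n).2 !opprB -addrA.
    by rewrite (addrAC (x ^+ n)) subrr add0r.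
  rewrite (le_trans (cnormD _ _))// !cnormN lerD ?cnormX//.
  by rewrite mulrC cnormM.
have -> : (1 - x) * l - 1 = - ((1 - x) * (s n - l)) - x ^+ n.
  rewrite mulrBr (geometric_sumE x n).1 !opprB -addrA.
  by rewrite (addrAC (x ^+ n)) subrr add0r.
by rewrite (le_trans (cnormD _ _))// !cnormN lerD ?cnormX ?cnormM.
Qed.

Lemma real_spectrum_le_cnorm a t : real_spectrum a t -> `|t| <= cnorm a.
Proof.
move=> at_; rewrite leNgt; apply/negP => a_lt_t; apply: at_.
have t0 : t != 0 by rewrite -normr_gt0 (le_lt_trans (cnorm_ge0 a)).
have tV : t%:C * t^-1%:C = 1 by rewrite -rmorphM /= mulfV.
have [|b [bl br]] := @one_sub_invertible (t^-1%:C *: a).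
  rewrite cnormZr normc_def /= expr0n addr0 sqrtr_sqr normfV mulrC.
  by rewrite ltr_pdivrMr ?normr_gt0// mul1r.
have -> : a - t%:C%:A = - t%:C *: (1 - t^-1%:C *: a).
  by rewrite scalerBr !scaleNr scalerA tV scale1r opprK addrC.
exists (- t^-1%:C *: b); rewrite -!scalerAl -!scalerAr bl br scalerA.
by rewrite scalerA !mulrNN tV mulrC tV !scale1r.
Qed.

End CstarNorm.

(** * Diagonal operators *)

Section Operators.
Variables (R : realType) (H : hilbertType R).
Implicit Types (T U : H -> H) (x y : H) (M : R).

Lemma normHE x : (complex.Re `|x|)%:C = `|x|.
Proof. exact/RRe_real/normr_real. Qed.

Lemma op_norm_set_inf T : bounded_op T ->
  has_inf [set M | 0 <= M /\ op_bound T M].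
Proof.
move=> [_ [M TM]]; split; last by exists 0 => N [].
exists (Num.max 0 M); split; first by rewrite le_max lexx.
move=> x; apply: le_trans (TM x) _.
by rewrite ler_wpM2r// lecR le_max lexx orbT.
Qed.

Lemma bounded_opD T x y : bounded_op T -> T (x + y) = T x + T y.
Proof. by move=> [TL _]; rewrite -[x in LHS]scale1r TL scale1r. Qed.

Lemma bounded_op0 T : bounded_op T -> T 0 = 0.
Proof.
move=> Tb; have := bounded_opD 0 0 Tb; rewrite addr0 => /eqP.
by rewrite -subr_eq subrr eq_sym => /eqP.
Qed.

(** The infimum that defines the operator norm is attained. *)
Lemma op_norm_bound T : bounded_op T -> op_bound T (op_norm T).
Proof.
move=> Tb x; have infT := op_norm_set_inf Tb.
have [->|x0] := eqVneq x 0; first by rewrite bounded_op0// !normr0 mulr0.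
rewrite -(normHE (T x)) -(normHE x) -rmorphM /= lecR.
have nx0 : 0 < complex.Re `|x| by rewrite -ltcR normHE normr_gt0.
rewrite -ler_pdivrMr//; apply: lb_le_inf; first exact: infT.1.
move=> M [M0 TM]; rewrite ler_pdivrMr// -lecR rmorphM /= !normHE.
exact: TM.
Qed.

Lemma op_norm_le T M : 0 <= M -> op_bound T M -> op_norm T <= M.
Proof. by move=> M0 TM; apply: ge_inf; [exists 0 => N []|]. Qed.

Lemma bounded_opZ T (z : R[i]) x : bounded_op T -> T (z *: x) = z *: T x.
Proof. by move=> Tb; rewrite -[z *: x]addr0 Tb.1 bounded_op0// addr0. Qed.

Lemma bounded_op_sum T (I : Type) (r : seq I) (F : I -> H) :
  bounded_op T -> T (\sum_(i <- r) F i) = \sum_(i <- r) T (F i).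
Proof.
move=> Tb; elim: r => [|i r IH]; first by rewrite !big_nil bounded_op0.
by rewrite !big_cons bounded_opD// IH.
Qed.

Variable e : nat -> H.
Hypothesis basis_e : orthonormal_basis e.

Lemma basis_neq0 k : e k != 0.
Proof.
apply/eqP => ek0; have := basis_e.1 k k; rewrite ek0 eqxx linear0l.
by move/eqP; rewrite eq_sym oner_eq0.
Qed.

Lemma pythagoras (a : nat -> R[i]) n :
  `|\sum_(k < n) a k *: e k| ^+ 2 = \sum_(k < n) `|a k| ^+ 2.
Proof.
elim: n => [|n IH]; first by rewrite !big_ord0 normr0 expr0n.
rewrite !big_ord_recr /= -dot_norm dnormD /= !dot_norm IH.
have -> : dot (\sum_(k < n) a k *: e k) (a n *: e n) = 0.
  rewrite linear_sumlz /= big1// => k _.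
  by rewrite linearZl_LR linearZr_LR /= basis_e.1 ltn_eqF// !mulr0.
rewrite rmorph0 !addr0 normrZ exprMn.
by rewrite -(dot_norm (e n)) basis_e.1 eqxx mulr1.
Qed.

Lemma basis_approx x (eps : R) : 0 < eps ->
  exists n (a : nat -> R[i]), `|x - \sum_(k < n) a k *: e k| <= eps%:C.
Proof.
move=> eps0; have /cvgrPdist_le/(_ eps%:C) := basis_e.2 x.
rewrite ltcR => /(_ eps0)[n _ /(_ n (leqnn n))] /=.
by rewrite /series /= big_mkord => xn; exists n, (fun k => dot x (e k)).
Qed.

(** On finite combinations of the basis this is the Pythagorean theorem; the
    general case follows by density, any bound [K] of [T] controlling the
    remainder. *)
Lemma diagonal_op_bound T (d : nat -> R[i]) M : bounded_op T -> 0 <= M ->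
  (forall k, T (e k) = d k *: e k) -> (forall k, `|d k| <= M%:C) ->
  op_bound T M.
Proof.
move=> Tb M0 Td dM x.
have MC0 : 0 <= M%:C by rewrite ler0c.
have [K K0 TK] : exists2 K, 0 <= K & op_bound T K.
  by have [K [K0 TK]] := (op_norm_set_inf Tb).1; exists K.
rewrite -(normHE (T x)) -(normHE x) -rmorphM lecR; apply/ler_addgt0Pr => eps eps0.
have E : 0 < K + M + 1 by rewrite ltr_wpDl// addr_ge0.
have [n [a]] := basis_approx x (divr_gt0 eps0 E).
set s := \sum_(k < n) _ => sx.
rewrite -lecR rmorphD rmorphM /= !normHE.
have Ts : `|T s| <= M%:C * `|s|.
  rewrite -(@ler_pXn2r _ 2)// ?nnegrE ?mulr_ge0//.
  rewrite exprMn /s bounded_op_sum//.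
  under eq_bigr => k _ do rewrite bounded_opZ// Td scalerA.
  rewrite (pythagoras (fun k => a k * d k)) pythagoras mulr_sumr.
  apply: ler_sum => k _; rewrite normrM exprMn mulrC.
  by rewrite ler_wpM2r// ler_pXn2r ?nnegrE.
have -> : T x = T s + T (x - s) by rewrite -bounded_opD// addrC subrK.
rewrite (le_trans (ler_normD _ _))//.
have s_le : `|s| <= `|x| + `|x - s|.
  by rewrite -{1}(subKr x s) (le_trans (ler_normB _ _)).
rewrite (le_trans (lerD Ts (TK _)))//.
rewrite (le_trans (lerD (ler_wpM2l MC0 s_le) (lexx _)))//.
rewrite mulrDr -addrA lerD2l -mulrDl -rmorphD /=.
apply: (@le_trans _ _ ((K + M + 1)%:C * (eps / (K + M + 1))%:C)).
  by rewrite ler_pM ?ler0c ?addr_ge0// lecR (addrC M) lerDl.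
by rewrite -rmorphM /= mulrC divfK// lt0r_neq0.
Qed.

Lemma bounded_op_sub T U : bounded_op T -> bounded_op U ->
  bounded_op (fun x => T x - U x).
Proof.
move=> Tb Ub; split.
  move=> z x y; rewrite (bounded_opD _ _ Tb) (bounded_opD _ _ Ub).
  by rewrite (bounded_opZ _ _ Tb) (bounded_opZ _ _ Ub) opprD addrACA scalerBr.
exists (op_norm T + op_norm U) => x; rewrite rmorphD mulrDl.
by rewrite (le_trans (ler_normB _ _))// lerD// op_norm_bound.
Qed.

Lemma eq_bounded_op T U : bounded_op T -> bounded_op U ->
  (forall k, T (e k) = U (e k)) -> T = U.
Proof.
move=> Tb Ub TU; apply/funext => x; apply/eqP; rewrite -subr_eq0 -normr_le0.
have := @diagonal_op_bound _ (fun=> 0) 0 (bounded_op_sub Tb Ub) (lexx 0) _ _ x.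
by rewrite mul0r; apply=> k; rewrite ?normr0// TU subrr scale0r.
Qed.

End Operators.

(** * Functional calculus of a diagonal element *)

Section PolynomialCalculus.
Variables (R : realType) (A : cstarAlgType R) (a : A).
Implicit Types p : {poly R}.

Lemma poly_calculusB p1 p2 :
  poly_calculus a (p1 - p2) = poly_calculus a p1 - poly_calculus a p2.
Proof. by rewrite /poly_calculus !rmorphB. Qed.

Variables (H : hilbertType R) (pi : A -> H -> H).
Hypothesis pi_rep : is_star_rep pi.

Lemma repB x y v : pi (x - y) v = pi x v - pi y v.
Proof.
by rewrite (repD pi_rep) -scaleN1r (repZ pi_rep) scaleN1r.
Qed.

Lemma rep_poly_calculus t v p :
  pi a v = t%:C *: v -> pi (poly_calculus a p) v = p.[t]%:C *: v.
Proof.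
move=> av; rewrite /poly_calculus.
elim/poly_ind: p => [|p c IH].
  rewrite rmorph0 rmorph0 horner0 -(subrr 1) repB subrr.
  by rewrite rmorph0 scale0r.
rewrite !(rmorphD, rmorphM) /= map_polyX map_polyC horner_algX.
rewrite [X in _ + X](horner_algC a) (repD pi_rep) (repM pi_rep).
rewrite av (bounded_opZ _ _ (rep_bounded pi_rep _)) IH.
rewrite (repZ pi_rep) (rep1 pi_rep) !hornerE scalerA -scalerDl.
by rewrite rmorphD rmorphM mulrC.
Qed.

Lemma eigenvalue_real_spectrum t v :
  v != 0 -> pi a v = t%:C *: v -> real_spectrum a t.
Proof.
move=> v0 av [b [bl _]]; move/eqP: v0; apply.
rewrite -[LHS](rep1 pi_rep) -bl (repM pi_rep) repB av.
rewrite (repZ pi_rep) (rep1 pi_rep) subrr.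
exact: bounded_op0 (rep_bounded pi_rep b).
Qed.

(** Eigenvectors of [a] are eigenvectors of [f(a)]: the eigenvalue [t] lies in the
    spectrum, where the polynomials defining [f(a)] converge to [f], and the
    representation is continuous. In particular the values of [f(a)] do not
    depend on the polynomials, which makes the calculus well defined as soon as
    eigenvectors determine elements. *)
Lemma rep_cfc f x t v : (forall y, op_norm (pi y) <= cnorm y) ->
  v != 0 -> pi a v = t%:C *: v -> is_cfc a f x -> pi x v = (f t)%:C *: v.
Proof.
move=> pi_le v0 av [p [pf px]].
have at_ : real_spectrum a t by exact: eigenvalue_real_spectrum av.
have {}pf : (p n).[t] @[n --> \oo] --> f t.
  have : {uniform [set t], (fun n s => (p n).[s]) @ \oo --> f}.
    by apply: uniform_subset_cvg pf => _ ->.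
  by rewrite uniform_set1.
apply/eqP; rewrite -subr_eq0 -normr_le0.
suff : complex.Re `|pi x v - (f t)%:C *: v| <= 0 by rewrite -lecR normHE.
pose K := complex.Re `|v|.
have nv0 : 0 < K by rewrite -ltcR normHE normr_gt0.
apply/ler_addgt0Pr => eps eps0; rewrite add0r.
pose eps' := eps / (K + K).
have eps'0 : 0 < eps' by rewrite divr_gt0 ?addr_gt0.
move/cvgrPdist_le : pf => /(_ _ eps'0) pf.
move/cvgrPdist_le : px => /(_ _ eps'0) px.
have [n [pfn pxn]] := filter_ex (filterI pf px).
rewrite sub0r normrN ger0_norm ?cnorm_ge0// in pxn.
set u := poly_calculus a (p n) in pxn.
have uv : pi u v = (p n).[t]%:C *: v by exact: rep_poly_calculus.
have epsE : eps%:C = eps'%:C * `|v| + eps'%:C * `|v|.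
  rewrite -normHE -!rmorphM -rmorphD /=; congr (_%:C); rewrite /eps' -/K.
  by rewrite -mulrDr divfK// lt0r_neq0// addr_gt0.
rewrite -lecR normHE epsE.
have -> : pi x v - (f t)%:C *: v =
    - pi (u - x) v + ((p n).[t] - f t)%:C *: v.
  by rewrite repB uv rmorphB scalerBl opprB addrA subrK.
rewrite (le_trans (ler_normD _ _))// normrN lerD//.
  rewrite (le_trans (op_norm_bound (rep_bounded pi_rep _) v))//.
  by rewrite ler_wpM2r// lecR (le_trans (pi_le _)).
rewrite normrZ ler_wpM2r// normc_def /= expr0n addr0 sqrtr_sqr lecR.
by rewrite distrC.
Qed.

End PolynomialCalculus.

Section DiagonalCalculus.
Variables (R : realType) (A : cstarAlgType R) (H : hilbertType R).
Variables (e : nat -> H) (pi1 pi2 : A -> H -> H).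
Variable D : set ((H -> H) * (H -> H)).
Hypothesis basis_e : orthonormal_basis e.
Hypothesis iso : is_cstar_iso pi1 pi2 D.

Let pi1_rep : is_star_rep pi1. Proof. by case: iso. Qed.
Let pi2_rep : is_star_rep pi2. Proof. by case: iso. Qed.

Lemma cstar_iso_contractive x :
  op_norm (pi1 x) <= cnorm x /\ op_norm (pi2 x) <= cnorm x.
Proof. by case: iso => _ _ _ ->; rewrite !le_max !lexx orbT. Qed.

Lemma cnorm_diagonal_le (u1 u2 : nat -> R) x M : 0 <= M ->
  (forall k, pi1 x (e k) = (u1 k)%:C *: e k) -> (forall k, `|u1 k| <= M) ->
  (forall k, pi2 x (e k) = (u2 k)%:C *: e k) -> (forall k, `|u2 k| <= M) ->
  cnorm x <= M.
Proof.
have normCR (t : R) : `|t%:C| = `|t|%:C.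
  by rewrite normc_def /= expr0n addr0 sqrtr_sqr.
move=> M0 x1 u1M x2 u2M; case: iso => _ _ _ ->; rewrite ge_max.
apply/andP; split; apply: op_norm_le => //.
  apply: (diagonal_op_bound basis_e (rep_bounded pi1_rep x) M0 x1) => k.
  by rewrite normCR lecR.
apply: (diagonal_op_bound basis_e (rep_bounded pi2_rep x) M0 x2) => k.
by rewrite normCR lecR.
Qed.

Variables (a : A) (d1 d2 : nat -> R).
Hypothesis a1 : forall k, pi1 a (e k) = (d1 k)%:C *: e k.
Hypothesis a2 : forall k, pi2 a (e k) = (d2 k)%:C *: e k.
Hypothesis d1_le : forall k, `|d1 k| <= 1.
Hypothesis d2_le : forall k, `|d2 k| <= 1.

Let real_spectrum_le1 t : real_spectrum a t -> t \in `[-1, 1]%R.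
Proof.
move=> /real_spectrum_le_cnorm ta; rewrite in_itv /= -ler_norml.
exact: le_trans ta (cnorm_diagonal_le ler01 a1 d1_le a2 d2_le).
Qed.

Let cnorm_poly_le (p : {poly R}) M : 0 <= M ->
  (forall t, t \in `[-1, 1]%R -> `|p.[t]| <= M) ->
  cnorm (poly_calculus a p) <= M.
Proof.
move=> M0 pM.
have bd (d : nat -> R) : (forall k, `|d k| <= 1) -> forall k, `|p.[d k]| <= M.
  by move=> d_le k; apply: pM; rewrite in_itv /= -ler_norml.
apply: (@cnorm_diagonal_le (fun k => p.[d1 k]) (fun k => p.[d2 k])) => //.
- by move=> k; exact: rep_poly_calculus.
- exact: bd.
- by move=> k; exact: rep_poly_calculus.
- exact: bd.
Qed.

(** The norm of a polynomial in [a] is at most its supremum on [[-1, 1]], since [a]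
    is diagonal with eigenvalues there; hence polynomials converging uniformly
    to [f] give a Cauchy sequence. The spectrum of [a] stays in [[-1, 1]] because
    [a] has norm at most [1]. *)
Lemma cfc_diagonal_exists (f : R -> R) :
  {within `[-1, 1], continuous f} -> exists x, is_cfc a f x.
Proof.
move=> fC.
have /choice[p pP] : forall n, exists p : {poly R},
    forall t, t \in `[-1, 1]%R -> `|p.[t] - f t| <= n.+1%:R^-1.
  by move=> n; apply: weierstrass; rewrite ?gtrN// ?ltr01.
have small (eps : R) : 0 < eps ->
    exists N, forall n, (N <= n)%N -> n.+1%:R^-1 <= eps.
  move=> eps0; exists (Num.truncn eps^-1) => n Nn.
  rewrite invf_ple ?posrE//; apply: ltW; apply: lt_le_trans (truncnS_gt _) _.
  by rewrite ler_nat ltnS.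
have [|x xP] := cnorm_complete (fun n => poly_calculus a (p n)).
  move=> eps eps0; have [|N NP] := small (eps / 3); first by rewrite divr_gt0.
  exists N => m n Nm Nn; rewrite -poly_calculusB.
  apply: (@le_lt_trans _ _ (eps / 3 + eps / 3)); last by lra.
  apply: cnorm_poly_le => [|t t1]; first by lra.
  rewrite !hornerE; have -> : (p m).[t] - (p n).[t] =
    ((p m).[t] - f t) - ((p n).[t] - f t) by ring.
  rewrite (le_trans (ler_normB _ _))// lerD//.
    exact: le_trans (pP _ _ t1) (NP _ Nm).
  exact: le_trans (pP _ _ t1) (NP _ Nn).
exists x, p; split => //.
move=> P /uniform_nbhs[E [entE EP]].
move: entE; rewrite -entourage_ballE => -[eps /= eps0 ballE].
have [|N NP] := small (eps / 2); first by rewrite divr_gt0.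
exists N => // n /= Nn; apply: EP => t /real_spectrum_le1 t1.
apply: ballE; rewrite /= /ball /= distrC.
by rewrite (le_lt_trans (pP n t t1))// (le_lt_trans (NP _ Nn))//; lra.
Qed.

Lemma rep_cfc_diagonal (f : R -> R) :
  {within `[-1, 1], continuous f} -> forall k,
  pi1 (cfc a f) (e k) = (f (d1 k))%:C *: e k /\
  pi2 (cfc a f) (e k) = (f (d2 k))%:C *: e k.
Proof.
move=> fC k; have cfcP : is_cfc a f (cfc a f).
  exact: (xgetPex 0 (cfc_diagonal_exists fC)).
have e0 := basis_neq0 basis_e k.
split.
  by apply: (rep_cfc pi1_rep _ e0 (a1 k) cfcP) => y;
     case: (cstar_iso_contractive y).
by apply: (rep_cfc pi2_rep _ e0 (a2 k) cfcP) => y;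
   case: (cstar_iso_contractive y).
Qed.

Lemma cstar_iso_inj x y :
  (forall k, pi1 x (e k) = pi1 y (e k)) ->
  (forall k, pi2 x (e k) = pi2 y (e k)) -> x = y.
Proof.
move=> xy1 xy2; case: iso => _ _ [_ inj _] _.
apply: inj; rewrite ?in_setT// /rep_sum; congr pair.
  by apply: (eq_bounded_op basis_e) => //; exact: rep_bounded.
by apply: (eq_bounded_op basis_e) => //; exact: rep_bounded.
Qed.

End DiagonalCalculus.

(** * The spheres *)

Section PodlesFunctions.
Variables (R : realType) (q c : R).
Hypothesis hq : 0 < `|q| < 1.

(** The two pieces agree at [0] and glue to a combination of [x] and [`|x|],
    from which continuity can be read off. *)
Lemma podles_FE x : podles_F c x = Num.sqrt (c + 4^-1) * x + 2^-1 * `|x|.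
Proof.
rewrite /podles_F /lambda_plus /lambda_minus; case: ltP => x0.
  by rewrite ltr0_norm//; ring.
by rewrite ger0_norm//; ring.
Qed.

(** The two branches of [G] are the two branches of [F] inside [eta]. *)
Lemma podles_GE x : podles_G q c x =
  (Num.sqrt (1 - q ^+ 4 * x ^+ 2))^-1 * Defs.eta c (q ^+ 2 * podles_F c x).
Proof.
rewrite /podles_G /podles_F; case: ifP => _; congr (_ * Defs.eta c _).
  by rewrite mulrA.
by rewrite !mulNr mulrN mulrA.
Qed.

Lemma podles_F_continuous : continuous (podles_F c).
Proof.
rewrite (_ : podles_F c = fun x => Num.sqrt (c + 4^-1) * x + 2^-1 * `|x|).
  move=> x; apply: continuousD; first exact: mulrl_continuous.
  apply: continuousM; first exact: cst_continuous.
  exact: norm_continuous.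
by apply/funext => x; exact: podles_FE.
Qed.

Lemma eta_continuous : continuous (Defs.eta c).
Proof.
move=> x; apply: continuous_comp; last exact: sqrt_continuous.
apply: continuousD; last exact: cst_continuous.
apply: continuousB; first exact: id.
exact: exprn_continuous.
Qed.

Lemma podles_radicand_gt0 x : `|x| <= 1 -> 0 < 1 - q ^+ 4 * x ^+ 2.
Proof.
move=> x1; rewrite subr_gt0; have [q0 q1] := andP hq.
have q40 : 0 <= q ^+ 4 by rewrite (exprM q 2 2) sqr_ge0.
have q4 : q ^+ 4 < 1 by rewrite -(ger0_norm q40) normrX exprn_ilt1.
have x2 : x ^+ 2 <= 1 by rewrite -real_normK ?num_real// exprn_ile1.
by apply: le_lt_trans q4; rewrite -[leRHS]mulr1 ler_wpM2l.
Qed.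

Lemma podles_G_continuous : {within `[-1, 1], continuous (podles_G q c)}.
Proof.
rewrite (_ : podles_G q c = fun x =>
  (Num.sqrt (1 - q ^+ 4 * x ^+ 2))^-1 * Defs.eta c (q ^+ 2 * podles_F c x)).
  apply: continuous_in_subspaceT => x; rewrite inE/= in_itv/= -ler_norml => x1.
  have sqx : continuous (fun y : R => 1 - q ^+ 4 * y ^+ 2).
    move=> y; apply: cvgB; first exact: cvg_cst.
    by apply: cvgM; [exact: cvg_cst|exact: exprn_continuous].
  apply: cvgM.
    apply: cvgV; first by rewrite gt_eqF// sqrtr_gt0 podles_radicand_gt0.
    apply: (@continuous_comp _ _ _ (fun y : R => 1 - q ^+ 4 * y ^+ 2)).
      exact: sqx.
    exact: sqrt_continuous.
  apply: (@continuous_comp _ _ _ (fun y : R => q ^+ 2 * podles_F c y)).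
    by apply: cvgM; [exact: cvg_cst|exact: podles_F_continuous].
  exact: eta_continuous.
by apply/funext => x; exact: podles_GE.
Qed.

Let q0 : q != 0. Proof. by rewrite -normr_gt0; case/andP: hq. Qed.

Lemma expr_even_gt0 k : 0 < q ^+ (2 * k).
Proof. by rewrite exprM exprn_gt0// exprn_even_gt0. Qed.

Lemma expr_even_le1 k : q ^+ (2 * k) <= 1.
Proof.
rewrite exprM exprn_ile1 ?sqr_ge0// -real_normK ?num_real// exprn_ile1//.
by rewrite ltW//; case/andP: hq.
Qed.

Lemma podles_eigenvalue_le1 s k : `|s| = 1 -> `|s * q ^+ (2 * k)| <= 1.
Proof.
by move=> s1; rewrite normrM s1 mul1r gtr0_norm ?expr_even_gt0 ?expr_even_le1.
Qed.

Lemma podles_F_plus k : podles_F c (1 * q ^+ (2 * k)) =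
  lambda_plus c * q ^+ (2 * k).
Proof. by rewrite mul1r /podles_F ltW ?expr_even_gt0. Qed.

Lemma podles_F_minus k : podles_F c (-1 * q ^+ (2 * k)) =
  lambda_minus c * q ^+ (2 * k).
Proof.
rewrite /podles_F mulN1r oppr_ge0 leNgt expr_even_gt0 /=.
by rewrite mulrNN.
Qed.

(** Since [B] lowers the index, [G] is evaluated at the eigenvalue of index [k]
    on the image of [e k.+1]; the factor [q ^+ 2] inside [G] restores the index
    [k.+1], and its prefactor cancels the weight of [B]. *)
Lemma podles_G_shift s l k : `|s| = 1 ->
  podles_F c (s * q ^+ (2 * k)) = l * q ^+ (2 * k) ->
  Num.sqrt (1 - q ^+ (4 * k.+1)) * podles_G q c (s * q ^+ (2 * k)) =
  Num.sqrt (l * q ^+ (2 * k.+1) - (l * q ^+ (2 * k.+1)) ^+ 2 + c).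
Proof.
move=> s1 Fl; rewrite podles_GE Fl.
have -> : q ^+ 4 * (s * q ^+ (2 * k)) ^+ 2 = q ^+ (4 * k.+1).
  rewrite exprMn -(real_normK (num_real s)) s1 expr1n mul1r -exprM -exprD.
  by rewrite mulnAC -(mulnS 4).
rewrite mulVKf; last first.
  rewrite gt_eqF// sqrtr_gt0 subr_gt0 (exprM q 4) exprn_ilt1//.
    by rewrite (exprM q 2 2) sqr_ge0.
  by have := @podles_radicand_gt0 1; rewrite expr1n mulr1 subr_gt0; apply;
     rewrite normr1.
by rewrite /Defs.eta mulrCA -exprD -mulnS.
Qed.

End PodlesFunctions.

(** Componentwise form of the proposition: [s] and [l] are [1] and [lambda_plus],
    or [-1] and [lambda_minus]. The elements [x] and [y] stand for [F(a)] and
    [G(a)], of which only the eigenvalues matter. *)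
Lemma podles_rep_intertwine (R : realType) (q c : R) (H : hilbertType R)
    (e : nat -> H) (A A' : cstarAlgType R) (a b x y : A) (a' b' : A') (s l : R)
    (pi : A -> H -> H) (pi' : A' -> H -> H) :
  0 < `|q| < 1 -> `|s| = 1 ->
  (forall k, podles_F c (s * q ^+ (2 * k)) = l * q ^+ (2 * k)) ->
  is_podles_inf_rep q e a b s pi -> is_podles_rep q e c a' b' l pi' ->
  (forall k, pi x (e k) = (podles_F c (s * q ^+ (2 * k)))%:C *: e k) ->
  (forall k, pi y (e k) = (podles_G q c (s * q ^+ (2 * k)))%:C *: e k) ->
  (forall k, pi' a' (e k) = pi x (e k)) /\
  (forall k, pi' b' (e k) = pi (y * b) (e k)).
Proof.
move=> hq s1 Fl piP pi'P piF piG; have pi_rep := podles_inf_rep_star piP.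
split=> k; first by rewrite (podles_repA pi'P) piF Fl.
rewrite (repM pi_rep); case: k => [|k].
  rewrite (podles_repB0 pi'P) (podles_inf_repB0 piP).
  by rewrite (bounded_op0 (rep_bounded pi_rep _)).
rewrite (podles_repB pi'P)// (podles_inf_repB piP)//=.
rewrite (bounded_opZ _ _ (rep_bounded pi_rep _)) piG scalerA -rmorphM.
by rewrite (podles_G_shift hq s1 (Fl k)).
Qed.

Theorem proposition2p2 (R : realType) (q : R) (hq : 0 < `|q| < 1)
    (c : R) (hc : 0 < c)
    (* C(S^2_{q infty}) and C(S^2_{qc}) *)
    (Cinf : cstarAlgType R) (iota_inf : {lrmorphism podles_inf q -> Cinf})
    (closure_inf : is_cstar_closure iota_inf)
    (Cc : cstarAlgType R) (iota_c : {lrmorphism podles q hc -> Cc})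
    (closure_c : is_cstar_closure iota_c)
    (H : hilbertType R) (e : nat -> H) (basis_e : orthonormal_basis e)
    (* pi_+, pi_-, pi^c_+ and pi^c_- *)
    (pip pim : Cinf -> H -> H)
    (pipP : is_podles_inf_rep q e
      (iota_inf (podles_infA q)) (iota_inf (podles_infB q)) 1 pip)
    (pimP : is_podles_inf_rep q e
      (iota_inf (podles_infA q)) (iota_inf (podles_infB q)) (-1) pim)
    (picp picm : Cc -> H -> H)
    (picpP : is_podles_rep q e c
      (iota_c (podlesA q hc)) (iota_c (podlesB q hc)) (lambda_plus c) picp)
    (picmP : is_podles_rep q e c
      (iota_c (podlesA q hc)) (iota_c (podlesB q hc)) (lambda_minus c) picm)
    (* the shift, the symbol map and the two known isomorphisms *)
    (S : H -> H) (shiftS : is_shift e S)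
    (sigma : (H -> H) -> R[i]^o -> R[i]^o) (symbol : is_symbol_map S sigma)
    (iso_inf : is_cstar_iso pip pim (toeplitz_pullback S sigma))
    (iso_c : is_cstar_iso picp picm (toeplitz_pullback S sigma)) :
  let A := iota_inf (podles_infA q) in
  let B := iota_inf (podles_infB q) in
  let chi_c : Cc -> Cinf :=
    'pinv_(fun=> 0) [set: Cinf] (rep_sum pip pim) \o rep_sum picp picm in
  chi_c (iota_c (podlesA q hc)) = cfc A (podles_F c) /\
  chi_c (iota_c (podlesB q hc)) = cfc A (podles_G q c) * B.
Proof.
move=> A B chi_c.
have [_ _ [_ _ surj] _] := iso_inf.
have [_ _ [repc_sub _ _] _] := iso_c.
have chi_rep y : pip (chi_c y) = picp y /\ pim (chi_c y) = picm y.
  have : rep_sum pip pim (chi_c y) = rep_sum picp picm y.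
    by apply: (surjpK _ surj); rewrite inE; exact: repc_sub.
  by case.
have norm1 : `|1 : R| = 1 by rewrite normr1.
have normN1 : `|-1 : R| = 1 by rewrite normrN1.
have calc := rep_cfc_diagonal basis_e iso_inf
  (podles_inf_repA pipP) (podles_inf_repA pimP)
  (fun k => podles_eigenvalue_le1 hq k norm1)
  (fun k => podles_eigenvalue_le1 hq k normN1).
have FA := calc _ (continuous_subspaceT (@podles_F_continuous R c)).
have GA := calc _ (@podles_G_continuous R q c hq).
have [pA pB] := podles_rep_intertwine hq norm1 (podles_F_plus c hq) pipP picpP
  (fun k => (FA k).1) (fun k => (GA k).1).
have [mA mB] := podles_rep_intertwine hq normN1 (podles_F_minus c hq) pimP picmP
  (fun k => (FA k).2) (fun k => (GA k).2).
split; apply: (cstar_iso_inj basis_e iso_inf) => k.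
- by rewrite (chi_rep _).1 pA.
- by rewrite (chi_rep _).2 mA.
- by rewrite (chi_rep _).1 pB.
- by rewrite (chi_rep _).2 mB.
Qed.
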